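(* Let $(M,h,\nabla)$ be a statistical manifold with $h$ a non-degenerate symmetric $(0,2)$-tensor field, and let $J:TM\to TM$ be an $h$-symmetric $(1,1)$-tensor field such that $\nabla J$ is $h$-symmetric. Let $$\hat J_-=\begin{pmatrix} J & -(I+J^2)h^{-1}\\ h & -J^*\end{pmatrix}$$ be the generalized almost complex structure on $TM\oplus T^*M$ induced by $(h,J)$. Then $$N_{\hat J_-}^{\nabla^{(\alpha)}}(X+\eta,Y+\beta)=N_{\hat J_-}^{\nabla}(X+\eta,Y+\beta)$$ for all vector fields $X,Y$, all $1$-forms $\eta,\beta$ and all $\alpha\in\mathbb{R}$. In particular, integrability of $\hat J_-$ is $\alpha$-invariant: for every $\alpha\in\mathbb{R}$, $N_{\hat J_-}^{\nabla^{(\alpha)}}=0$ if and only if $N_{\hat J_-}^{\nabla}=0$.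
   Context: The tensor $h$ is identified with the bundle isomorphism $h:TM\to T^*M$, $h(X)=h(X,\cdot)$, with inverse $h^{-1}$. $(M,h,\nabla)$ is a statistical manifold if $\nabla$ is a torsion-free affine connection and $(\nabla_Xh)(Y,Z)=(\nabla_Yh)(X,Z)$ for all $X,Y,Z$. $J$ is $h$-symmetric if $h(JX,Y)=h(X,JY)$; $\nabla J$ is $h$-symmetric if $h((\nabla_XJ)Y,Z)=h((\nabla_XJ)Z,Y)$ for all $X,Y,Z$; $(J^*\eta)(X)=\eta(JX)$. The matrix means $\hat J_-(X+\eta)=JX-(I+J^2)h^{-1}(\eta)+h(X)-J^*\eta$. The dual connection $\nabla^*$ is defined by $X(h(Y,Z))=h(\nabla_XY,Z)+h(Y,\nabla^*_XZ)$, and $\nabla^{(\alpha)}=\frac{1+\alpha}{2}\nabla+\frac{1-\alpha}{2}\nabla^*$. For an affine connection $D$ on $M$ (acting on $1$-forms by $(D_X\beta)(Y)=X(\beta(Y))-\beta(D_XY)$), the bracket is $[X+\eta,Y+\beta]_D=[X,Y]+D_X\beta-D_Y\eta$, and the Nijenhuis tensor of an endomorphism $\hat J$ of $TM\oplus T^*M$ with respect to $D$ is $N_{\hat J}^{D}(\sigma,\tau)=[\hat J\sigma,\hat J\tau]_D-\hat J[\hat J\sigma,\tau]_D-\hat J[\sigma,\hat J\tau]_D+\hat J^2[\sigma,\tau]_D$. $\hat J$ is integrable with respect to $[\cdot,\cdot]_D$ if $N_{\hat J}^D=0$. *)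

(* Defs.v *)
From HB Require Import structures.
From mathcomp Require Import all_boot all_order all_algebra.
From mathcomp Require Import all_classical all_reals all_analysis.
From mathcomp Require Import ring.

Set Implicit Arguments.
Unset Strict Implicit.
Unset Printing Implicit Defensive.

Import Order.TTheory GRing.Theory Num.Theory.
Import numFieldNormedType.Exports.

Local Open Scope classical_set_scope.
Local Open Scope ring_scope.

Section SmoothEuclidean.
Context {R : realType} {n : nat}.
Implicit Types (U : set 'rV[R]_n) (f g : 'rV[R]_n -> R).

Definition basis_vector (i : 'I_n) : 'rV[R]_n := delta_mx 0 i.

(* f is of class C^k on the open set U; values of f outside U are irrelevant
   (see is_Ck_ext). *)
Fixpoint is_Ck (k : nat) U f : Prop :=
  (forall x, U x -> {for x, continuous f}) /\
  match k with
  | 0%N => True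
  | k'.+1 => forall i : 'I_n,
      (forall x, U x -> derivable f x (basis_vector i)) /\
      is_Ck k' U ('D_(basis_vector i) f)
  end.

Definition is_smooth_on U f : Prop := forall k, is_Ck k U f.

Lemma is_Ck_ext k U f g : open U -> (forall x, U x -> f x = g x) ->
  is_Ck k U f -> is_Ck k U g.
Proof.
move=> oU.
have near_eq (f1 g1 : 'rV[R]_n -> R) x : (forall y, U y -> f1 y = g1 y) ->
    U x -> \forall y \near x, f1 y = g1 y.
  by move=> fg Ux; apply: filterS fg _; exact: open_nbhs_nbhs.
have eq_cont (f1 g1 : 'rV[R]_n -> R) : (forall y, U y -> f1 y = g1 y) ->
    (forall x, U x -> {for x, continuous f1}) ->
    forall x, U x -> {for x, continuous g1}.
  move=> fg fc x Ux; rewrite /prop_for /continuous_at -(fg x Ux).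
  apply: cvg_trans (fc x Ux); apply: (@near_eq_cvg _ _ (nbhs x)).
  by apply: near_eq => // y /fg.
elim: k f g => [|k IHk] f g fg [fc fk].
  by split=> //; exact: eq_cont fg fc.
split=> [|i]; first exact: eq_cont fg fc.
have [fd fk'] := fk i; split=> [x Ux|].
  by apply: near_eq_derivable (fd x Ux); exact: near_eq.
by apply: IHk fk' => x Ux; apply: near_eq_derive; exact: near_eq.
Qed.

Lemma is_CkW k U f : is_Ck k.+1 U f -> is_Ck k U f.
Proof.
elim: k f => [|k IHk] f [fc fk]; split=> // i.
by have [fd fk'] := fk i; split=> //; exact: IHk.
Qed.

Lemma is_Ck_cst k U (c : R) : open U -> is_Ck k U (cst c).
Proof.
move=> oU; elim: k c => [|k IHk] c; split=> //.
1, 2: by move=> x _; exact: cst_continuous.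
move=> i; split=> [x _|]; first exact: derivable_cst.
apply: (is_Ck_ext (f := cst 0)) => // x _.
by rewrite derive_cst.
Qed.

Lemma is_CkD k U f g : open U ->
  is_Ck k U f -> is_Ck k U g -> is_Ck k U (f + g).
Proof.
move=> oU; elim: k f g => [|k IHk] f g [fc fk] [gc gk]; split=> //.
1, 2: by move=> x Ux; exact: (continuousD (fc x Ux) (gc x Ux)).
move=> i; have [fd fk'] := fk i; have [gd gk'] := gk i.
split=> [x Ux|]; first by apply: derivableD; [exact: fd | exact: gd].
apply: (is_Ck_ext (f := 'D_(basis_vector i) f + 'D_(basis_vector i) g)) => //.
  by move=> x Ux; rewrite deriveD//; [exact: fd | exact: gd].
exact: IHk.
Qed.

Lemma is_CkM k U f g : open U ->
  is_Ck k U f -> is_Ck k U g -> is_Ck k U (f * g).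
Proof.
move=> oU; elim: k f g => [|k IHk] f g Cf Cg; move: (Cf) (Cg) => [fc fk] [gc gk].
all: split=> //.
1, 2: by move=> x Ux; exact: (continuousM (fc x Ux) (gc x Ux)).
move=> i; have [fd fk'] := fk i; have [gd gk'] := gk i.
split=> [x Ux|]; first by apply: derivableM; [exact: fd | exact: gd].
apply: (is_Ck_ext
    (f := f * 'D_(basis_vector i) g + g * 'D_(basis_vector i) f)) => //.
  by move=> x Ux; rewrite deriveM//; [exact: fd | exact: gd].
by apply: is_CkD => //; apply: IHk => //; exact: is_CkW.
Qed.

End SmoothEuclidean.

(* The inverse of a chart is a total function; only its values on the open
   image of the chart are meaningful. *)
Record chart (R : realType) (n : nat) (M : topologicalType) := Chart {
  chart_dom : set M;
  chart_map : M -> 'rV[R]_n;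
  chart_inv : 'rV[R]_n -> M;
  chart_dom_open : open chart_dom;
  chart_img_open : open (chart_map @` chart_dom);
  chart_mapK : forall p, chart_dom p -> chart_inv (chart_map p) = p;
  chart_map_continuous : forall p, chart_dom p -> {for p, continuous chart_map};
  chart_inv_continuous : forall x, (chart_map @` chart_dom) x ->
    {for x, continuous chart_inv}
}.

Definition smooth_transition (R : realType) (n : nat) (M : topologicalType)
    (c d : chart R n M) : Prop :=
  forall i : 'I_n,
    is_smooth_on (chart_map c @` (chart_dom c `&` chart_dom d))
      (fun x => chart_map d (chart_inv c x) 0 i).

Record manifold (R : realType) (n : nat) := Manifold {
  mcarrier :> topologicalType;
  manifold_hausdorff : hausdorff_space mcarrier;
  manifold_second_countable : @second_countable mcarrier;
  atlas : set (chart R n mcarrier);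
  atlas_cover : forall p : mcarrier, exists2 c, atlas c & chart_dom c p;
  atlas_compatible : forall c d, atlas c -> atlas d -> smooth_transition c d
}.

Section SmoothFunctions.
Context {R : realType} {n : nat} (M : manifold R n).

Definition is_smooth (f : M -> R) : Prop :=
  forall c, atlas c ->
    is_smooth_on (chart_map c @` chart_dom c) (f \o chart_inv c).

Definition is_smoothb : {pred M -> R} := fun f => `[< is_smooth f >].

Fact is_smooth_subring_closed : subring_closed is_smoothb.
Proof.
have sm_cst (a : R) : is_smooth (cst a).
  by move=> c _ k; apply: is_Ck_cst; exact: chart_img_open.
split=> [|f g|f g].
- exact/asboolP/sm_cst.
- move=> /asboolP sf /asboolP sg; apply/asboolP => c Ac k.
  have oU := @chart_img_open _ _ _ c.
  have := is_CkM oU (sm_cst (- 1) c Ac k) (sg c Ac k).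
  move/(is_CkD oU (sf c Ac k)); apply: is_Ck_ext => // x _.
  by rewrite /= !fctE mulN1r.
- move=> /asboolP sf /asboolP sg; apply/asboolP => c Ac k.
  exact: is_CkM (@chart_img_open _ _ _ c) (sf c Ac k) (sg c Ac k).
Qed.

HB.instance Definition _ :=
  GRing.isSubringClosed.Build (M -> R) is_smoothb is_smooth_subring_closed.

Record smooth_function := SmoothFunction {
  smooth_val :> M -> R;
  _ : smooth_val \in is_smoothb
}.

HB.instance Definition _ := [isSub for smooth_val].
HB.instance Definition _ := [Choice of smooth_function by <:].
HB.instance Definition _ :=
  GRing.SubChoice_isSubComPzRing.Build _ _ smooth_function
    (GRing.subringClosedP _).

Fact is_smoothb_cst (a : R) : (cst a : M -> R) \in is_smoothb.
Proof. by apply/asboolP => c _ k; apply: is_Ck_cst; exact: chart_img_open. Qed.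

Definition smooth_cst (a : R) : smooth_function :=
  SmoothFunction (is_smoothb_cst a).

End SmoothFunctions.

(* Smooth vector fields are the R-linear derivations of C^oo(M). *)
Section VectorFields.
Context {R : realType} {n : nat} (M : manifold R n).
Local Notation A := (smooth_function M).

Definition is_derivation (D : A -> A^o) : Prop :=
  [/\ forall f g : A, D (f + g) = D f + D g,
      forall (a : R) (f : A), D (smooth_cst M a * f) = smooth_cst M a * D f
    & forall f g : A, D (f * g) = f * D g + g * D f].

Definition is_derivationb : {pred A -> A^o} := fun D => `[< is_derivation D >].

Fact is_derivation_submod_closed : submod_closed is_derivationb.
Proof.
split=> [|u D E].
  by apply/asboolP; split=> *; rewrite /= ?addr0 ?mulr0 ?addr0.
move=> /asboolP[Da Dc DM] /asboolP[Ea Ec EM]; apply/asboolP.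
have linE f : (u *: D + E) f = u * D f + E f by [].
split=> [f g|a f|f g]; rewrite !linE.
- by rewrite Da Ea; ring.
- by rewrite Dc Ec; ring.
- by rewrite DM EM; ring.
Qed.

HB.instance Definition _ :=
  GRing.isSubmodClosed.Build A (A -> A^o) is_derivationb
    is_derivation_submod_closed.

Record vector_field := VectorField {
  vf_val :> A -> A^o;
  _ : vf_val \in is_derivationb
}.

HB.instance Definition _ := [isSub for vf_val].
HB.instance Definition _ := [Choice of vector_field by <:].
HB.instance Definition _ := [SubChoice_isSubLmodule of vector_field by <:].

Implicit Types X Y : vector_field.

Lemma vf_derivation X : is_derivation X.
Proof. by case: X => D /= /asboolP. Qed.

Fact lie_bracket_subproof X Y :
  ((fun f => X (Y f) - Y (X f)) : A -> A^o) \in is_derivationb.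
Proof.
have [Xa Xc XM] := vf_derivation X; have [Ya Yc YM] := vf_derivation Y.
apply/asboolP; split=> [f g|a f|f g].
- by rewrite Ya Xa Xa Ya; ring.
- by rewrite Yc Xc Xc Yc; ring.
- by rewrite YM Xa !XM Ya !YM; ring.
Qed.

Definition lie_bracket X Y : vector_field :=
  VectorField (lie_bracket_subproof X Y).

End VectorFields.

(* Smooth 1-forms are the C^oo(M)-linear maps from vector fields to C^oo(M);
   likewise, tensor fields are represented by their C^oo(M)-multilinear action
   on sections. *)
Section OneForms.
Context {R : realType} {n : nat} (M : manifold R n).
Local Notation A := (smooth_function M).
Local Notation VF := (vector_field M).

Definition is_one_formb : {pred VF -> A^o} := fun w => `[< linear w >].

Fact is_one_form_submod_closed : submod_closed is_one_formb.
Proof.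
split=> [|u v w]; first by apply/asboolP => f X Y; rewrite /= scaler0 addr0.
move=> /asboolP lv /asboolP lw; apply/asboolP => f X Y.
have linE Z : (u *: v + w) Z = u *: v Z + w Z by [].
by rewrite !linE lv lw /GRing.scale/=; ring.
Qed.

HB.instance Definition _ :=
  GRing.isSubmodClosed.Build A (VF -> A^o) is_one_formb
    is_one_form_submod_closed.

Record one_form := OneForm {
  form_val :> VF -> A^o;
  _ : form_val \in is_one_formb
}.

HB.instance Definition _ := [isSub for form_val].
HB.instance Definition _ := [Choice of one_form by <:].
HB.instance Definition _ := [SubChoice_isSubLmodule of one_form by <:].

Lemma form_linear (w : one_form) : linear w.
Proof. by case: w => w /= /asboolP. Qed.

HB.instance Definition _ (w : one_form) :=
  GRing.isLinear.Build A VF A^o *:%R (form_val w) (form_linear w).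

Lemma vector_fieldP (X Y : VF) : (forall f, X f = Y f) -> X = Y.
Proof. by move=> XY; apply/val_inj/funext. Qed.

Lemma one_formP (v w : one_form) : (forall X, v X = w X) -> v = w.
Proof. by move=> vw; apply/val_inj/funext. Qed.

Definition section : Type := (VF * one_form)%type.
HB.instance Definition _ := GRing.Lmodule.on section.

End OneForms.

Arguments one_form {R n} M.
Arguments vector_field {R n} M.
Arguments section {R n} M.

Section Connections.
Context {R : realType} {n : nat} {M : manifold R n}.
Local Notation A := (smooth_function M).
Local Notation VF := (vector_field M).

Record connection := Connection {
  nabla :> VF -> VF -> VF;
  nabla_linear : forall (f : A) (X X' Y : VF),
    nabla (f *: X + X') Y = f *: nabla X Y + nabla X' Y;
  nabla_additive : forall X Y Y' : VF,
    nabla X (Y + Y') = nabla X Y + nabla X Y';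
  nabla_leibniz : forall (X Y : VF) (f : A),
    nabla X (f *: Y) = X f *: Y + f *: nabla X Y
}.

Implicit Types (D : connection) (X Y Z : VF).

Fact nabla_form_subproof D X (beta : one_form M) :
  ((fun Y => X (beta Y) - beta (D X Y)) : VF -> A^o) \in @is_one_formb _ _ M.
Proof.
have [Xa _ XM] := vf_derivation X.
have betaD Y Z : beta (Y + Z) = beta Y + beta Z by rewrite linearD.
have betaZ (f : A) Y : beta (f *: Y) = f * beta Y by rewrite linearZ.
apply/asboolP => f Y Z; rewrite nabla_additive nabla_leibniz.
by rewrite !betaD !betaZ Xa XM /GRing.scale/=; ring.
Qed.

Definition nabla_form D X (beta : one_form M) : one_form M :=
  OneForm (nabla_form_subproof D X beta).

Definition torsion_free D : Prop :=
  forall X Y, D X Y - D Y X = lie_bracket X Y.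

(* A (0,2)-tensor field h is represented by X |-> h(X, .), i.e. identified with
   the bundle map TM -> T*M, so that h X Y stands for h(X, Y). *)
Definition tensor02 := {linear VF -> one_form M}.

(* A (1,1)-tensor field, i.e. a bundle endomorphism of TM. *)
Definition tensor11 := {linear VF -> VF}.

Implicit Types (h : tensor02) (J : tensor11).

Definition symmetric_tensor h : Prop := forall X Y, h X Y = h Y X.

(* h is non-degenerate on each tangent space: a tangent vector X_p which is
   h_p-orthogonal to all tangent vectors at p is zero. *)
Definition nondegenerate_tensor h : Prop :=
  forall (p : M) X, (forall Y, (h X Y : A) p = 0) ->
    forall f : A, (X f : A) p = 0.

Definition cov_deriv_tensor02 D h X Y Z : A :=
  X (h Y Z) - h (D X Y) Z - h Y (D X Z).

Definition cov_deriv_tensor11 D J X Y : VF := D X (J Y) - J (D X Y).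

Definition statistical h D : Prop :=
  torsion_free D /\
  forall X Y Z, cov_deriv_tensor02 D h X Y Z = cov_deriv_tensor02 D h Y X Z.

Definition h_symmetric h J : Prop := forall X Y, h (J X) Y = h X (J Y).

Definition cov_deriv_h_symmetric h D J : Prop :=
  forall X Y Z,
    h (cov_deriv_tensor11 D J X Y) Z = h (cov_deriv_tensor11 D J X Z) Y.

Definition dual_connection h D (Dstar : connection) : Prop :=
  forall X Y Z, X (h Y Z) = h (D X Y) Z + h Y (Dstar X Z).

Section Alpha.
Variables (D Dstar : connection) (alpha : R).

Let a : A := smooth_cst M ((1 + alpha) / 2).
Let b : A := smooth_cst M ((1 - alpha) / 2).

Let abE : a + b = 1.
Proof.
apply/val_inj/funext => p /=; change ((1 + alpha) / 2 + (1 - alpha) / 2 = 1 :> R).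
by field.
Qed.

Let nab X Y : VF := a *: D X Y + b *: Dstar X Y.

Let nab_linear f X X' Y : nab (f *: X + X') Y = f *: nab X Y + nab X' Y.
Proof.
rewrite /nab !nabla_linear !scalerDr !scalerA (mulrC a) (mulrC b).
by rewrite addrACA.
Qed.

Let nab_additive X Y Y' : nab X (Y + Y') = nab X Y + nab X Y'.
Proof. by rewrite /nab !nabla_additive !scalerDr addrACA. Qed.

Let nab_leibniz X Y (f : A) : nab X (f *: Y) = X f *: Y + f *: nab X Y.
Proof.
rewrite /nab !nabla_leibniz !scalerDr addrACA !scalerA -!scalerDl.
by rewrite -mulrDl abE mul1r (mulrC a) (mulrC b).
Qed.

Definition alpha_connection : connection :=
  Connection nab_linear nab_additive nab_leibniz.

End Alpha.

Definition section_bracket D (s t : section M) : section M :=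
  (lie_bracket s.1 t.1, nabla_form D s.1 t.2 - nabla_form D t.1 s.2).

Definition nijenhuis D (Jh : {linear section M -> section M})
    (s t : section M) : section M :=
  section_bracket D (Jh s) (Jh t) - Jh (section_bracket D (Jh s) t)
  - Jh (section_bracket D s (Jh t)) + Jh (Jh (section_bracket D s t)).

Definition integrable_endo D (Jh : {linear section M -> section M}) : Prop :=
  forall s t, nijenhuis D Jh s t = 0.

Fact pullback_subproof J (eta : one_form M) :
  ((fun X => eta (J X)) : VF -> A^o) \in @is_one_formb _ _ M.
Proof. by apply/asboolP => f X Y; rewrite !linearP. Qed.

Definition pullback J (eta : one_form M) : one_form M :=
  OneForm (pullback_subproof J eta).

Definition gacs_minus h (hinv : {linear one_form M -> VF}) J
    (s : section M) : section M :=
  let: (X, eta) := s in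
  (J X - (hinv eta + J (J (hinv eta))), h X - pullback J eta).

Fact gacs_minus_linear h hinv J : linear (gacs_minus h hinv J).
Proof.
have pbE f eta beta :
    pullback J (f *: eta + beta) = f *: pullback J eta + pullback J beta.
  by apply: one_formP.
have linB (V : lmodType A) (f : A) (u u' v v' : V) :
    f *: u + u' - (f *: v + v') = f *: (u - v) + (u' - v').
  by rewrite scalerBr opprD addrACA.
move=> f [X eta] [Y beta]; congr (_, _).
  by rewrite !linearP addrACA -scalerDr linB.
by rewrite pbE linearP linB.
Qed.

HB.instance Definition _ h hinv J :=
  GRing.isLinear.Build A (section M) (section M) *:%R (gacs_minus h hinv J)
    (gacs_minus_linear h hinv J).

End Connections.

(* Main.v *)
(** Put [K X Y = Dstar X Y - D X Y].  Duality gives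
    [h Y (K X Z) = (D_X h)(Y, Z)], so [K] is symmetric because [D h] is totally
    symmetric, and [h]-symmetry of [D J] gives
    [K X (J Y) = K (J X) Y = J (K X Y)].  The brackets of the alpha-connection
    and of [D] differ by the 1-form [h E], where
    [E (X + h A, Y + h B) = (1 - alpha) / 2 *: (K Y A - K X B)].  The
    commutation of [K] with [J] shows that the generalized structure [Jh] satisfies
    [E (Jh s, t) + E (s, Jh t) = 0] and [E (Jh s, Jh t) = E (s, t)]; together
    with [Jh ^ 2 = - 1], all contributions of [E] to the Nijenhuis tensor
    cancel. *)
Require Import Defs.
From HB Require Import structures.
From mathcomp Require Import all_boot all_order all_algebra.
From mathcomp Require Import all_classical all_reals all_analysis.
From mathcomp Require Import ring.
Import Order.TTheory GRing.Theory Num.Theory.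
Import numFieldNormedType.Exports.
Local Open Scope ring_scope.

(** The shape of the Nijenhuis tensor, with [b1] to [b4] the old brackets and [e], [f] their
    changes: the two copies of [L f] cancel, and [L (L e) = - e] removes [e]. *)
Lemma complex_structure_cancel (V : zmodType) (L : {additive V -> V})
    (b1 b2 b3 b4 e f : V) : (forall u, L (L u) = - u) ->
  b1 + e - L (b2 - f) - L (b3 + f) + L (L (b4 + e)) =
  b1 - L b2 - L b3 + L (L b4).
Proof.
move=> L2; rewrite (raddfB L) (raddfD L) !L2 opprB !opprD !addrA.
by rewrite [LHS](ACl (1*4*5*7*(2*8)*(3*6)))/= !subrr !addr0.
Qed.

(* Locked, since [opprD] would otherwise unfold it to rewrite [- K X Y]. *)
HB.lock Definition diff_tensor (R : realType) (n : nat) (M : manifold R n)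
    (D Dstar : connection (M := M)) (X Y : vector_field M) : vector_field M :=
  Dstar X Y - D X Y.
Arguments diff_tensor {R n M} D Dstar X Y.

Section Connection.
Context {R : realType} {n : nat} {M : manifold R n}.
Implicit Types (D : connection (M := M)) (X Y Z : vector_field M).
Implicit Types (beta eta : one_form M).

Lemma vector_field_addE X Y f : (X + Y) f = X f + Y f.
Proof. by []. Qed.

Lemma vector_field_oppE X f : (- X) f = - X f.
Proof. by []. Qed.

Definition vector_fieldE := (vector_field_addE, vector_field_oppE).

Lemma tensor02Dl (h : tensor02 (M := M)) X Y Z : h (X + Y) Z = h X Z + h Y Z.
Proof. by rewrite linearD. Qed.

Lemma tensor02Bl (h : tensor02 (M := M)) X Y Z : h (X - Y) Z = h X Z - h Y Z.
Proof. by rewrite linearB. Qed.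

Lemma tensor02Zl (h : tensor02 (M := M)) a X Y : h (a *: X) Y = a * h X Y.
Proof. by rewrite linearZ. Qed.

Lemma nablaDl D X Y Z : D (X + Y) Z = D X Z + D Y Z.
Proof. by have := nabla_linear D 1 X Y Z; rewrite !scale1r. Qed.

Lemma nablaBl D X Y Z : D (X - Y) Z = D X Z - D Y Z.
Proof. by apply: (addIr (D Y Z)); rewrite -nablaDl !subrK. Qed.

Lemma alpha_connectionE D Dstar alpha X Y :
  alpha_connection D Dstar alpha X Y =
  D X Y + smooth_cst M ((1 - alpha) / 2) *: diff_tensor D Dstar X Y.
Proof.
rewrite diff_tensor.unlock /=; set a := smooth_cst M ((1 + alpha) / 2).
set b := smooth_cst M _.
have -> : a = 1 - b.
  apply/val_inj/funext => p.
  change ((1 + alpha) / 2 = 1 - (1 - alpha) / 2 :> R).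
  by field.
by rewrite scalerBl scale1r scalerBr addrAC addrA.
Qed.

Lemma nabla_form_alphaE D Dstar alpha X beta Y :
  nabla_form (alpha_connection D Dstar alpha) X beta Y =
  nabla_form D X beta Y
  - smooth_cst M ((1 - alpha) / 2) * beta (diff_tensor D Dstar X Y).
Proof.
transitivity (X (beta Y) - beta (alpha_connection D Dstar alpha X Y)) => //.
by rewrite alpha_connectionE linearD linearZ opprD addrA.
Qed.

End Connection.

Section StatisticalManifold.
Context {R : realType} {n : nat} {M : manifold R n}
  {h : {linear vector_field M -> one_form M}}
  {hinv : {linear one_form M -> vector_field M}}
  {D Dstar : connection (M := M)}
  {J : {linear vector_field M -> vector_field M}}.
Context (h_sym : symmetric_tensor h) (hK : cancel h hinv)
  (hinvK : cancel hinv h) (h_stat : statistical h D)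
  (Dstar_dual : dual_connection h D Dstar) (J_sym : h_symmetric h J)
  (DJ_sym : cov_deriv_h_symmetric h D J).

Local Notation K := (diff_tensor D Dstar).
Local Notation Jh := (gacs_minus h hinv J).

Lemma tensor_diffE X Y Z : h Y (K X Z) = cov_deriv_tensor02 D h X Y Z.
Proof.
rewrite /cov_deriv_tensor02 Dstar_dual diff_tensor.unlock linearB.
by rewrite [_ + h Y _]addrC addrK.
Qed.

(** Allows vector fields to be compared in the second slot of [h], where [tensor_diffE] applies. *)
Lemma tensor_inj X Y : (forall Z, h Z X = h Z Y) -> X = Y.
Proof.
move=> XY; apply: (can_inj hK); apply: one_formP => Z.
by rewrite h_sym XY h_sym.
Qed.

Lemma cov_deriv_tensor02C X Y Z :
  cov_deriv_tensor02 D h X Y Z = cov_deriv_tensor02 D h X Z Y.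
Proof.
rewrite /cov_deriv_tensor02 (h_sym Y Z) (h_sym (D X Y)) (h_sym Y).
by rewrite addrAC.
Qed.

(** The Codazzi equation swaps the first two arguments of [D h], symmetry of [h] the last two;
    together they swap the first and the third. *)
Lemma diff_tensorC X Y : K X Y = K Y X.
Proof.
have [_ codazzi] := h_stat; apply: tensor_inj => Z.
by rewrite !tensor_diffE cov_deriv_tensor02C codazzi cov_deriv_tensor02C.
Qed.

Lemma diff_tensorBl X Y Z : K (X - Y) Z = K X Z - K Y Z.
Proof.
rewrite diff_tensor.unlock !nablaBl.
by apply: vector_fieldP => f; rewrite !vector_fieldE; ring.
Qed.

Lemma diff_tensorBr X Y Z : K X (Y - Z) = K X Y - K X Z.
Proof. by rewrite !(diff_tensorC X) diff_tensorBl. Qed.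

(** Paired with [Z], the claim reads [(D_X h)(Z, J Y) = (D_X h)(J Z, Y)]. By [J_sym] the derivatives
    along [X] agree, and the other terms match by [DJ_sym X Y Z]. *)
Lemma diff_tensor_Jr X Y : K X (J Y) = J (K X Y).
Proof.
apply: tensor_inj => Z; rewrite -J_sym !tensor_diffE /cov_deriv_tensor02.
have := DJ_sym X Y Z; rewrite /cov_deriv_tensor11 !tensor02Bl.
rewrite !J_sym.
rewrite (h_sym (D X _)) (h_sym (D X _) (J _)) !J_sym.
by move/esym/(canRL (subrK _)) => ->; ring.
Qed.

Lemma diff_tensor_Jl X Y : K (J X) Y = J (K X Y).
Proof. by rewrite diff_tensorC diff_tensor_Jr diff_tensorC. Qed.

Definition bracket_defect (s t : section M) : vector_field M :=
  K t.1 (hinv s.2) - K s.1 (hinv t.2).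

Lemma section_bracket_alphaE alpha s t :
  section_bracket (alpha_connection D Dstar alpha) s t =
  section_bracket D s t
  + (0, h (smooth_cst M ((1 - alpha) / 2) *: bracket_defect s t)).
Proof.
case: s t => [X eta] [Y beta]; rewrite /section_bracket /bracket_defect /=.
congr (_, _); first by rewrite addr0.
(* [K V] is self-adjoint for [h], so composing [U] with [K V] gives the 1-form of [K V (hinv U)]. *)
have diffE (U : one_form M) V W : U (K V W) = h (K V (hinv U)) W.
  rewrite -{1}(hinvK U) tensor_diffE cov_deriv_tensor02C -tensor_diffE.
  exact: h_sym.
apply: one_formP => Z.
transitivity (nabla_form (alpha_connection D Dstar alpha) X beta Z
  - nabla_form (alpha_connection D Dstar alpha) Y eta Z) => //.
rewrite !nabla_form_alphaE !diffE.
transitivity (nabla_form D X beta Z - nabla_form D Y eta Z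
  + h (smooth_cst M ((1 - alpha) / 2) *: (K Y (hinv eta) - K X (hinv beta))) Z)
  => //.
by rewrite tensor02Zl tensor02Bl; ring.
Qed.

Lemma hinv_pullback eta : hinv (pullback J eta) = J (hinv eta).
Proof.
apply: (can_inj hK); rewrite hinvK; apply: one_formP => X.
by rewrite J_sym hinvK.
Qed.

(** Since [h] intertwines [J] and its pullback, [Jh] acts on pairs [(X, hinv eta)] by the matrix
    with rows [J, -(I + J^2)] and [I, -J]. Its trace is 0 and its determinant [I], so its square is
    [-I]. *)
Lemma gacs_minus2 s : Jh (Jh s) = - s.
Proof.
case: s => X eta; rewrite /gacs_minus; congr (_, _).
  rewrite !linearB hK hinv_pullback !linearD.
  by apply: vector_fieldP => f; rewrite !vector_fieldE; ring.
apply: one_formP => Y.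
transitivity (h (J X - (hinv eta + J (J (hinv eta)))) Y
  - (h X (J Y) - eta (J (J Y)))) => //.
rewrite tensor02Bl tensor02Dl !J_sym !hinvK.
transitivity (- eta Y) => //.
by ring.
Qed.

(** Up to sign, the defect is a 2x2 determinant for the product [K], which is symmetric and commutes
    with [J] in each argument; hence [Jh] multiplies it by its own determinant [I]. *)
Lemma bracket_defectJ s t : bracket_defect (Jh s) (Jh t) = bracket_defect s t.
Proof.
case: s t => [X eta] [Y beta]; rewrite /bracket_defect /=.
rewrite !linearB !hK !hinv_pullback.
move: (hinv eta) (hinv beta) => A B.
rewrite !opprD !addrA !diff_tensorBl !diff_tensorBr.
rewrite !(diff_tensor_Jl, diff_tensor_Jr).
(* Fixing the order of the arguments of each [K] lets [ring] recognise equal terms. *)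
rewrite (diff_tensorC Y X) (diff_tensorC B A) (diff_tensorC B X)
  (diff_tensorC Y A).
by apply: vector_fieldP => f; rewrite !vector_fieldE; ring.
Qed.

(** The infinitesimal counterpart: applying [Jh] to one argument at a time and adding multiplies the
    determinant by the trace of [Jh], which is 0. *)
Lemma bracket_defectJC s t :
  bracket_defect (Jh s) t = - bracket_defect s (Jh t).
Proof.
case: s t => [X eta] [Y beta]; rewrite /bracket_defect /=.
rewrite !linearB !hK !hinv_pullback.
move: (hinv eta) (hinv beta) => A B.
rewrite !opprD !addrA !diff_tensorBl !diff_tensorBr.
rewrite !(diff_tensor_Jl, diff_tensor_Jr).
rewrite (diff_tensorC Y X) (diff_tensorC B A) (diff_tensorC Y A).
by apply: vector_fieldP => f; rewrite !vector_fieldE; ring.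
Qed.

Lemma nijenhuis_alphaE alpha s t :
  nijenhuis (alpha_connection D Dstar alpha) Jh s t = nijenhuis D Jh s t.
Proof.
pose c := smooth_cst M ((1 - alpha) / 2).
pose E s t : section M := (0, h (c *: bracket_defect s t)).
have EJ : E (Jh s) (Jh t) = E s t by rewrite /E bracket_defectJ.
have EJC : E (Jh s) t = - E s (Jh t).
  (* The vector component [0] becomes [- 0], so that the whole pair is an opposite. *)
  by rewrite /E bracket_defectJC scalerN linearN -[in LHS]oppr0.
rewrite /nijenhuis !section_bracket_alphaE -/c -![(0, _)]/(E _ _) EJ EJC.
exact/complex_structure_cancel/gacs_minus2.
Qed.

End StatisticalManifold.

Theorem corollary4p12 (R : realType) (n : nat) (M : manifold R n)
  (h : {linear vector_field M -> one_form M})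
  (hinv : {linear one_form M -> vector_field M})
  (D Dstar : connection (M := M))
  (J : {linear vector_field M -> vector_field M})
  (h_sym : symmetric_tensor h)
  (h_nondeg : nondegenerate_tensor h)
  (hK : cancel h hinv) (hinvK : cancel hinv h)
  (h_stat : statistical h D)
  (Dstar_dual : dual_connection h D Dstar)
  (J_sym : h_symmetric h J)
  (DJ_sym : cov_deriv_h_symmetric h D J) :
  (forall (alpha : R) (X Y : vector_field M) (eta beta : one_form M),
     nijenhuis (alpha_connection D Dstar alpha) (gacs_minus h hinv J)
       (X, eta) (Y, beta)
     = nijenhuis D (gacs_minus h hinv J) (X, eta) (Y, beta)) /\
  (forall alpha : R,
     integrable_endo (alpha_connection D Dstar alpha) (gacs_minus h hinv J) <->
     integrable_endo D (gacs_minus h hinv J)).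
Proof.
have NE alpha s t : nijenhuis (alpha_connection D Dstar alpha)
    (gacs_minus h hinv J) s t = nijenhuis D (gacs_minus h hinv J) s t.
  exact: nijenhuis_alphaE.
split=> [alpha X Y eta beta|alpha]; first exact: NE.
by split=> N0 s t; have := N0 s t; rewrite NE.
Qed.
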